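(* Let $\alpha,\beta>-1$ and let $m,n$ be non-negative integers. For $y\in\mathbb{R}$ define \[ R_{m,n}(y)=\int_{-1}^1(1-x)^\alpha (1+x)^\beta P_n^{(\alpha,\beta)}(x)P_{n+m}^{(\alpha,\beta)}(x+y)\,dx . \] Then \begin{multline*} R_{m,n}(y)= 2^{\alpha+\beta+1}\dfrac{\Gamma(\alpha+n+1)\Gamma(\beta+n+1)}{\Gamma(\alpha+\beta+2n+2)} \dfrac{\Gamma(\alpha+\beta+2m+2n+1)}{\Gamma(\alpha+\beta+m+n+1)}\dfrac{1}{n!\,m!}\left(\dfrac{y}{2}\right)^m \\ \cdot F_2\left(-m;\ \beta+n+1,\ -\beta-m-n;\ \alpha+\beta+2n+2,\ -\alpha-\beta-2m-2n;\ -\dfrac{2}{y},\dfrac{2}{y}\right). \end{multline*}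
   Context: $P_n^{(\alpha,\beta)}$ is the Jacobi polynomial, $P_n^{(\alpha,\beta)}(x)=\frac{(\alpha+1)_n}{n!}\sum_{k=0}^n\frac{(-n)_k(\alpha+\beta+n+1)_k}{(\alpha+1)_k\,k!}\left(\frac{1-x}{2}\right)^k$, where $(a)_k=a(a+1)\cdots(a+k-1)$ is the Pochhammer symbol. $F_2$ is the Appell function $F_2(a;b,b';c,c';u,v)=\sum_{k,l\ge 0}\frac{(a)_{k+l}(b)_k(b')_l}{(c)_k(c')_l\,k!\,l!}u^kv^l$; for $a=-m$ the sum terminates ($k+l\le m$), so $y^mF_2(-m;\dots;-2/y,2/y)$ is a polynomial in $y$, and the right-hand side is understood as this polynomial (in particular at $y=0$).
   Formalization: The quotient Γ(α+β+2m+2n+1)/Γ(α+β+m+n+1) is written as the Pochhammer symbol (α+β+m+n+1)_{m+n}; the two agree wherever the quotient is defined, and for m=n=0, α+β=-1, where it reads Γ(0)/Γ(0), the value is 1. *)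

(* Defs.v *)
From HB Require Import structures.
From mathcomp Require Import all_boot all_order all_algebra.
From mathcomp Require Import all_classical all_reals all_analysis.
Set Implicit Arguments. Unset Strict Implicit. Unset Printing Implicit Defensive.
Import Order.TTheory GRing.Theory Num.Theory.
Import numFieldNormedType.Exports.
Local Open Scope classical_set_scope.
Local Open Scope ring_scope.

Definition poch {R : ringType} (a : R) (k : nat) : R :=
  \prod_(i < k) (a + i%:R).

(* Euler Gamma function on the reals: Gamma(s) = int_0^oo t^(s-1) e^(-t) dt
   (Lebesgue integral; we only evaluate it at s > 0). *)
Definition Gamma {R : realType} (s : R) : R :=
  Rintegral (@lebesgue_measure R) `]0, +oo[%classic
    (fun t => t `^ (s - 1) * expR (- t)).

Definition jacobiP {R : realType} (n : nat) (a b x : R) : R :=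
  poch (a + 1) n / n`!%:R *
  \sum_(k < n.+1)
     (poch (- (n%:R)) k * poch (a + b + n%:R + 1) k
        / (poch (a + 1) k * k`!%:R)) * ((1 - x) / 2) ^+ k.

(* The polynomial y^m * F_2(-m; b, b'; c, c'; -2/y, 2/y)  (terminating sum,
   k + l <= m), written out as a polynomial in y so that it makes sense at y = 0:
   sum_{k+l<=m} (-m)_{k+l} (b)_k (b')_l / ((c)_k (c')_l k! l!) (-2)^k 2^l y^(m-k-l). *)
Definition yF2 {R : realType} (m : nat) (b b' c c' y : R) : R :=
  \sum_(k < m.+1) \sum_(l < (m - k).+1)
     (poch (- (m%:R)) (k + l) * poch b k * poch b' l
        / (poch c k * poch c' l * k`!%:R * l`!%:R))
     * (-2) ^+ k * 2 ^+ l * y ^+ (m - k - l).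

Definition Rmn {R : realType} (a b : R) (m n : nat) (y : R) : R :=
  Rintegral (@lebesgue_measure R) `[-1, 1]%classic
    (fun x => (1 - x) `^ a * (1 + x) `^ b * jacobiP n a b x
              * jacobiP (n + m) a b (x + y)).

(* Main.v *)
Require Import Defs.
From HB Require Import structures.
From mathcomp Require Import all_boot all_order all_algebra.
From mathcomp Require Import all_classical all_reals all_analysis.
From mathcomp Require Import zify ring lra measurable_realfun.
Import Order.TTheory GRing.Theory Num.Theory.
Import numFieldNormedType.Exports.
Local Open Scope ring_scope.
Local Open Scope classical_set_scope.

(* Expand [P_n(x)] in powers of [1 - x] and [P_(n+m)(x+y)] in powers of [1 + x].
   The integral becomes a double sum of beta integrals, in which the sum over
   the powers of [1 - x] is a Chu-Vandermonde sum: the moment of [(1+x)^k]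
   against [w P_n] is a single term, proportional to ['C(k, n)].  Hence only
   [k >= n] contributes, and what remains is the [F_2] sum term by term.
   The beta integral comes from Tonelli's theorem applied to
   [Gamma p * Gamma q]; that same identity at [q = 1] gives the recursion of
   [Gamma], and with it the finiteness of [Gamma]. *)

(** * Pochhammer symbols *)

Lemma poch0 {R : nzRingType} (a : R) : poch a 0 = 1.
Proof. by rewrite /poch big_ord0. Qed.

Lemma pochS {R : nzRingType} (a : R) k : poch a k.+1 = poch a k * (a + k%:R).
Proof. by rewrite /poch big_ord_recr. Qed.

Lemma pochD {R : nzRingType} (a : R) k l :
  poch a (k + l) = poch a k * poch (a + k%:R) l.
Proof.
elim: l => [|l IH]; first by rewrite addn0 poch0 mulr1.
by rewrite addnS !pochS IH mulrA natrD addrA.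
Qed.

Lemma pochSl {R : nzRingType} (a : R) k : poch a k.+1 = a * poch (a + 1) k.
Proof. by rewrite -addn1 addnC pochD pochS poch0 mul1r addr0. Qed.

Lemma poch_gt0 {R : numDomainType} (a : R) k : 0 < a -> 0 < poch a k.
Proof. by move=> a0; rewrite /poch; apply: prodr_gt0 => i _; apply: ltr_wpDr. Qed.

Lemma poch_neq0 {R : numDomainType} (a : R) k : 0 < a -> poch a k != 0.
Proof. by move=> a0; rewrite gt_eqF// poch_gt0. Qed.

(* Reversing the order of the factors. *)
Lemma pochN {R : comNzRingType} (x : R) l :
  poch (- x) l = (-1) ^+ l * poch (x + 1 - l%:R) l.
Proof.
rewrite /poch [in RHS](reindex_inj rev_ord_inj) /=.
rewrite -[in (-1) ^+ l](card_ord l) -prodr_const -big_split /=.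
apply: eq_bigr => i _; rewrite natrB //= -natr1; ring.
Qed.

(** For [j > n] the left side contains the factor [- n + n] and the falling factorial is zero, so
    the identity is uniform in [j]. *)
Lemma pochN_nat {R : comNzRingType} (n j : nat) :
  poch (- n%:R : R) j = (-1) ^+ j * (n ^_ j)%:R.
Proof.
elim: j => [|j IH]; first by rewrite poch0 ffactn0 mulr1.
rewrite pochS IH ffactnSr natrM exprS; have [jn|nj] := leqP j n.
  by rewrite natrB//; ring.
by rewrite ffact_small// mul0r !mulr0 mul0r.
Qed.

(* Chu-Vandermonde with the denominators cleared, hence valid for every [c]. *)
Lemma chu_vandermonde {R : comNzRingType} (n : nat) (b c : R) :
  \sum_(j < n.+1) (-1) ^+ j * 'C(n, j)%:R * poch b j * poch (c + j%:R) (n - j)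
  = poch (c - b) n.
Proof.
elim: n b c => [|n IH] b c; first by rewrite big_ord_recl big_ord0 bin0 !poch0; ring.
rewrite big_ord_recl bin0 poch0 subn0 addr0.
(* Pascal's rule splits the sum in two; the halves yield the factors [c + n] and [- b], which add up
   to the last factor of [poch (c - b) n.+1]. *)
under eq_bigr => i _ do rewrite lift0 binS natrD mulrDr !mulrDl.
rewrite big_split /= addrA.
have -> : (-1) ^+ 0 * 1%:R * 1 * poch c n.+1 +
   \sum_(i < n.+1) (-1) ^+ i.+1 * 'C(n, i.+1)%:R * poch b i.+1
       * poch (c + i.+1%:R) (n.+1 - i.+1) =
   (c + n%:R) * poch (c - b) n.
  rewrite -IH big_distrr /= big_ord_recr /= bin_small// mulr0 !mul0r addr0.
  rewrite [RHS]big_ord_recl bin0 subn0 addr0 poch0 pochS.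
  congr (_ + _); first by ring.
  apply: eq_bigr => i _; rewrite lift0 subSS.
  (* The symbol based at [c + i.+1] ends with the factor [c + n], the same for every [i]. *)
  have -> : (n - i = (n - i.+1).+1)%N by rewrite -subSn ?subSS// ltn_ord.
  rewrite [poch (c + _) _]pochS natrB//; ring.
have -> : \sum_(i < n.+1) (-1) ^+ i.+1 * 'C(n, i)%:R * poch b i.+1
       * poch (c + i.+1%:R) (n.+1 - i.+1) = - b * poch (c - b) n.
  (* The induction hypothesis is used at [b + 1] and [c + 1], which have the same difference. *)
  have -> : c - b = (c + 1) - (b + 1) by ring.
  rewrite -IH big_distrr /=; apply: eq_bigr => i _.
  have -> : c + i.+1%:R = c + 1 + i%:R by rewrite -natr1; ring.
  rewrite subSS pochSl exprS.
  ring.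
rewrite pochS; ring.
Qed.

Lemma chu_vandermonde_quotient {R : numFieldType} (n : nat) (b c : R) : 0 < c ->
  \sum_(j < n.+1) poch (- n%:R) j * poch b j / (poch c j * j`!%:R)
  = poch (c - b) n / poch c n.
Proof.
move=> c0; have cn0 k : poch c k != 0 by rewrite gt_eqF// poch_gt0.
rewrite -chu_vandermonde big_distrl /=; apply: eq_bigr => j _.
have jn : (j <= n)%N by rewrite -ltnS.
have cn : poch c n = poch c j * poch (c + j%:R) (n - j) by rewrite -pochD subnKC.
have := cn0 n; rewrite cn mulf_eq0 negb_or => /andP[h1 h2].
have h3 : j`!%:R != 0 :> R by rewrite pnatr_eq0 -lt0n fact_gt0.
rewrite pochN_nat// -bin_ffact natrM.
by field; rewrite h1 h2 h3.
Qed.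

(** * Reflection of a terminating hypergeometric sum *)

Lemma fact_neq0 {R : numDomainType} n : n`!%:R != 0 :> R.
Proof. by rewrite pnatr_eq0 -lt0n fact_gt0. Qed.

Lemma bin_factE {R : numFieldType} n k : (k <= n)%N ->
  'C(n, k)%:R = n`!%:R / (k`!%:R * (n - k)`!%:R) :> R.
Proof.
move=> kn; rewrite -(bin_fact kn) !natrM mulfK// mulf_neq0 ?fact_neq0//.
Qed.

(** After binomial expansion of [(1 - s) ^+ k], the coefficient of [s ^+ i] is a Chu-Vandermonde sum
    with both parameters raised by [i]. This carries the expansion of a Jacobi polynomial from the
    endpoint 1 to the endpoint -1. *)
Lemma sum_reflected_term {R : numFieldType} (N : nat) (c lam s : R) : 0 < c ->
  \sum_(k < N.+1) poch (- N%:R) k * poch lam k / (poch c k * k`!%:R) * (1 - s) ^+ k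
  = \sum_(i < N.+1)
      'C(N, i)%:R * poch lam i * poch (c - lam) (N - i) / poch c N * s ^+ i.
Proof.
move=> c0.
pose u k : R := poch (- N%:R) k * poch lam k / (poch c k * k`!%:R).
transitivity (\sum_(k < N.+1) \sum_(i < N.+1) u k * 'C(k, i)%:R * (- s) ^+ i).
  apply: eq_bigr => k _; rewrite -/(u k) exprDn big_distrr /=.
  rewrite (big_ord_widen N.+1 (fun i => u k * (1 ^+ (k - i) * (- s) ^+ i *+ 'C(k, i))))//.
  rewrite big_mkcond /=; apply: eq_bigr => i _; rewrite expr1n mul1r.
  case: ifPn => [_|]; first by rewrite -mulr_natl mulrA.
  by rewrite ltnS -ltnNge => ki; rewrite bin_small// mulr0 mul0r.
rewrite exchange_big /=; apply: eq_bigr => i _.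
have iN : (i <= N)%N by rewrite -ltnS.
rewrite -big_distrl /= exprNn mulrA; congr (_ * _).
rewrite -(big_mkord xpredT (fun k => u k * 'C(k, i)%:R)).
(* Terms with [k < i] vanish through ['C(k, i)]; the rest are reindexed by [k = i + j]. *)
rewrite (big_cat_nat (leq0n i))//=; last exact: leqW.
rewrite big_nat_cond big1 ?add0r => [|k /andP[/andP[_ ki] _]]; last first.
  by rewrite bin_small// mulr0.
rewrite -{1}[i : nat]add0n big_addn subSn// big_mkord.
have ci : 0 < c + i%:R by rewrite ltr_wpDr.
have cv := chu_vandermonde_quotient (N - i) (lam + i%:R) (c + i%:R) ci.
transitivity (poch (- N%:R) i * poch lam i / (poch c i * i`!%:R) *
   (poch (c + i%:R - (lam + i%:R)) (N - i) / poch (c + i%:R) (N - i)) * (-1) ^+ i).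
  rewrite -cv; congr (_ * _); rewrite big_distrr /=; apply: eq_bigr => j _.
  rewrite /u addnC !pochD bin_factE ?leq_addr// addKn natrB//.
  have -> : - N%:R + i%:R = - (N%:R - i%:R) :> R by ring.
  by field; rewrite !poch_neq0// !fact_neq0.
have -> : poch c N = poch c i * poch (c + i%:R) (N - i) by rewrite -pochD subnKC.
have -> : c + i%:R - (lam + i%:R) = c - lam by ring.
rewrite pochN_nat// -bin_ffact natrM.
(* One sign comes from [(- s) ^+ i], the other from [poch (- N) i]. *)
have s2 : ((-1) ^+ i * (-1) ^+ i = 1 :> R) by rewrite -expr2 sqrr_sign.
transitivity (((-1) ^+ i * (-1) ^+ i) *
  ('C(N, i)%:R * poch lam i * poch (c - lam) (N - i) /
  (poch c i * poch (c + i%:R) (N - i)))).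
  by field; rewrite !poch_neq0// !fact_neq0.
by rewrite s2 mul1r.
Qed.

(** * Gamma and beta integrals *)

(** Lebesgue measure equals [c] times its pushforward under the affine map: by uniqueness it
    suffices to compare the two on half-open intervals. Infinite integrals are allowed. *)
Lemma ge0_integral_affine (R : realType) (c d : R) (f : R -> \bar R) :
  0 < c -> measurable_fun setT f -> (forall x, (0 <= f x)%E) ->
  (\int[lebesgue_measure]_x f x =
     c%:E * \int[lebesgue_measure]_x f (c * x + d)%R)%E.
Proof.
move=> c0 mf f0.
pose phi : R -> R := fun x => c * x + d.
have mphi : measurable_fun setT phi.
  by apply: measurable_funD => //; apply: measurable_funM.
pose k : {nonneg R} := NngNum (ltW c0).
have nuE A : measurable A -> lebesgue_measure A =
    mscale k (pushforward lebesgue_measure (phi : _ -> measurableTypeR R)) A.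
  move=> mA; apply: lebesgue_measure_unique => //= _ [[u v] _ <-] /=.
  rewrite /mscale /= /pushforward.
  have -> : phi @^-1` `]u, v] = `](u - d) / c, (v - d) / c].
    apply/seteqP; split => x /=; rewrite !in_itv /= /phi;
    by rewrite ltr_pdivrMr // ler_pdivlMr // ltrBlDr lerBrDr mulrC.
  rewrite !lebesgue_measure_itv /= !lte_fin ltr_pM2r ?invr_gt0// ltrD2r.
  case: ifP => _; last by rewrite mule0.
  by rewrite -!EFinD -EFinM; congr EFin; field; rewrite gt_eqF.
rewrite (eq_measure_integral (mscale k (pushforward lebesgue_measure
    (phi : _ -> measurableTypeR R)))) => [|A mA _];
  last exact: (nuE mphi A mA).
rewrite ge0_integral_mscale//; congr (_ * _)%E.
by rewrite ge0_integral_pushforward.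
Qed.

(** The cut-off at 0 lets every Euler integral run over the whole line, so a change of variables
    never alters the domain. *)
Definition pos_powR {R : realType} (p x : R) : R :=
  if 0 < x then x `^ (p - 1) else 0.

Lemma pos_powR_ge0 {R : realType} (p x : R) : 0 <= pos_powR p x.
Proof. by rewrite /pos_powR; case: ifP => // _; exact: powR_ge0. Qed.

Lemma measurable_pos_powR {R : realType} (p : R) :
  measurable_fun setT (pos_powR p).
Proof.
apply: measurable_fun_ifT => //.
  exact: measurable_fun_ltr.
Qed.

Lemma pos_powRM {R : realType} (p c x : R) : 0 < c ->
  pos_powR p (c * x) = c `^ (p - 1) * pos_powR p x.
Proof.
move=> c0; rewrite /pos_powR pmulr_rgt0//; case: ifP => x0; last by rewrite mulr0.
by rewrite powRM// ltW.
Qed.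

(** For [s < 1] the integrand is unbounded at 0, so the fundamental theorem of calculus is applied
    on the intervals from [1 / (n + 1)] to 1, followed by monotone convergence. *)
Lemma integral_powR_unit {R : realType} (s : R) : 0 < s ->
  (\int[lebesgue_measure]_(x in `]0%R, 1%R]) (x `^ (s - 1))%:E = (s^-1)%:E)%E.
Proof.
move=> s0.
pose F (n : nat) : set R := `[n.+1%:R^-1, 1].
have FE : \bigcup_n F n = `]0, 1].
  apply/seteqP; split => x /=.
    move=> [n _]; rewrite /F /= !in_itv /= => /andP[h ->]; rewrite andbT.
    by apply: lt_le_trans h; rewrite invr_gt0.
  rewrite in_itv /= => /andP[x0 x1].
  exists (Num.truncn x^-1) => //; rewrite /F /= in_itv /= x1 andbT.
  rewrite invf_ple ?posrE//; exact/ltW/truncnS_gt.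
have mf : measurable_fun [set: R] (fun x : R => (x `^ (s - 1))%:E).
  by apply/measurable_EFinP; exact: measurable_powR.
have cv : (\int[lebesgue_measure]_(x in F n) (x `^ (s - 1))%:E)%E @[n --> \oo] -->
   (\int[lebesgue_measure]_(x in \bigcup_n F n) (x `^ (s - 1))%:E)%E.
  apply: ge0_nondecreasing_set_cvg_integral.
  - move=> n m nm; rewrite subsetEset => x; rewrite /F /= !in_itv /=.
    move=> /andP[h ->]; rewrite andbT; apply: le_trans h.
    by rewrite lef_pV2 ?posrE// ler_nat.
  - by move=> i; exact: measurable_itv.
  - by move=> i; apply: measurable_funTS.
  - by move=> i x _; rewrite lee_fin powR_ge0.
rewrite -FE; apply/esym; move/cvg_lim : cv => <- //.
apply/esym/cvg_lim => //.
pose G (x : R) : R := s^-1 * x `^ s.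
have intF n : (\int[lebesgue_measure]_(x in F n) (x `^ (s - 1))%:E =
    (s^-1 - s^-1 * (n.+1%:R^-1) `^ s)%:E)%E.
  (* For index 0 the interval is the single point 1, while the fundamental theorem requires distinct
     endpoints. *)
  case: n => [|n].
    by rewrite /F invr1 set_itv1 integral_set1 powR1 mulr1 subrr.
  have a0 : 0 < n.+2%:R^-1 :> R by rewrite invr_gt0.
  have dG (x : R) : 0 < x -> is_derive x 1 G (x `^ (s - 1)).
    move=> x0; rewrite /G.
    have d1 : derivable (@powR R ^~ s) x 1.
      by apply: derivable_powR; rewrite in_itv /= x0.
    have := powR_derive1 s; move=> /(_ x); rewrite in_itv /= x0 => /(_ isT).
    rewrite derive1E => e.
    apply: DeriveDef; first exact: derivableM.
    rewrite deriveMl//= e mulrA mulVf ?mul1r// gt_eqF//.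
  have cG (x : R) : 0 < x -> {for x, continuous G}.
    move=> x0; apply: differentiable_continuous; apply/derivable1_diffP.
    by have [] := dG _ x0.
  rewrite /F (@continuous_FTC2 _ _ G).
  - by rewrite /G powR1 mulr1.
  - by rewrite invf_lt1// ltr1n.
  - apply: continuous_in_subspaceT => x; rewrite inE /= in_itv /= => /andP[h _].
    apply: differentiable_continuous; apply/derivable1_diffP.
    apply: derivable_powR; rewrite in_itv /= andbT; exact: lt_le_trans h.
  - split.
    + move=> x; rewrite in_itv /= => /andP[h _].
      by have [] := dG _ (lt_trans a0 h).
    + by apply: cvg_at_right_filter; exact: cG.
    + by apply: cvg_at_left_filter; exact: cG.
  - move=> x; rewrite in_itv /= => /andP[h _].
    by rewrite derive1E; have [_ ->] := dG _ (lt_trans a0 h).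
rewrite (_ : (fun n => _) = (fun n => (s^-1 - s^-1 * (n.+1%:R^-1) `^ s)%:E)); last first.
  by apply/funext => n; exact: intF.
apply: cvg_EFin; first by near=> n.
rewrite -[X in _ --> X]subr0; apply: cvgB; first exact: cvg_cst.
rewrite -(mulr0 s^-1); apply: cvgM; first exact: cvg_cst.
have /cvg_at_rightP := powR_cvg0 s0; apply; split=> [n|].
  by rewrite invr_gt0.
exact: cvg_harmonic.
Unshelve. all: by end_near. Qed.

(** Extended real values allow Tonelli's theorem to be used before finiteness is known. *)
Definition eGamma {R : realType} (p : R) : \bar R :=
  (\int[lebesgue_measure]_x (pos_powR p x * expR (- x))%:E)%E.

(** This is the beta integral transported to the interval from -1 to 1, the shape of the Jacobi
    weight; it differs from the usual one by the factor [2 ^ (p + q - 1)]. *)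
Definition eBeta {R : realType} (p q : R) : \bar R :=
  (\int[lebesgue_measure]_x (pos_powR p (1 + x) * pos_powR q (1 - x))%:E)%E.

Lemma GammaE {R : realType} (p : R) : Gamma p = fine (eGamma p).
Proof.
rewrite /Gamma Rintegral_mkcond /Rintegral; congr fine; apply: eq_integral => x _.
rewrite patchE mem_setE in_itv /= andbT /pos_powR.
by case: ifP; rewrite ?mul0r.
Qed.

Lemma eGamma_ge0 {R : realType} (p : R) : (0 <= eGamma p)%E.
Proof.
by apply: integral_ge0 => x _; rewrite lee_fin mulr_ge0 ?pos_powR_ge0 ?expR_ge0.
Qed.

Lemma eBeta_ge0 {R : realType} (p q : R) : (0 <= eBeta p q)%E.
Proof.
by apply: integral_ge0 => x _; rewrite lee_fin mulr_ge0 ?pos_powR_ge0.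
Qed.

Lemma measurable_eGamma_fun {R : realType} (p : R) :
  measurable_fun setT (fun x : R => pos_powR p x * expR (- x)).
Proof.
apply: measurable_funM; first exact: measurable_pos_powR.
by apply: measurableT_comp => //; exact: measurableT_comp.
Qed.

Lemma measurable_eBeta_fun {R : realType} (p q : R) :
  measurable_fun setT (fun x : R => pos_powR p (1 + x) * pos_powR q (1 - x)).
Proof.
apply: measurable_funM; apply: measurableT_comp; (try exact: measurable_pos_powR).
  exact: measurable_funD.
exact: measurable_funB.
Qed.

(** Substitute [s = (u / 2) * (1 + x)]: the Jacobian contributes one power of [u / 2], the two
    factors contribute [p - 1] and [q - 1]. *)
Lemma integral_pos_powR_conv {R : realType} (p q u : R) : 0 < u ->
  (\int[lebesgue_measure]_s (pos_powR p s * pos_powR q (u - s))%:E =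
  ((u / 2) `^ (p + q - 1))%:E * eBeta p q)%E.
Proof.
move=> u0; have u20 : 0 < u / 2 by rewrite divr_gt0.
have mh : measurable_fun setT (fun s : R => (pos_powR p s * pos_powR q (u - s))%:E).
  apply/measurable_EFinP; apply: measurable_funM; first exact: measurable_pos_powR.
  by apply: measurableT_comp; [exact: measurable_pos_powR|exact: measurable_funB].
rewrite (ge0_integral_affine _ _ (u / 2) _ u20 mh); last first.
  by move=> x; rewrite lee_fin mulr_ge0 ?pos_powR_ge0.
rewrite (_ : (u / 2) `^ (p + q - 1) =
  (u / 2) * ((u / 2) `^ (p - 1) * (u / 2) `^ (q - 1))).
  rewrite (EFinM (u / 2)) -muleA; congr (_ * _)%E.
  rewrite /eBeta -ge0_integralZl//.
  - apply: eq_integral => x _; rewrite -EFinM; congr EFin.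
    have -> : u / 2 * x + u / 2 = u / 2 * (1 + x) by ring.
    have -> : u - u / 2 * (1 + x) = u / 2 * (1 - x) by field.
    by rewrite !pos_powRM//; ring.
  - by apply/measurable_EFinP; exact: measurable_eBeta_fun.
  - by move=> x _; rewrite lee_fin mulr_ge0 ?pos_powR_ge0.
  - by rewrite lee_fin mulr_ge0 ?powR_ge0.
rewrite -{2}(powRr1 (ltW u20)) -!powRD ?(gt_eqF u20) ?implybT//.
congr (_ `^ _); ring.
Qed.

Lemma lebesgue_tonelli {R : realType} (f : R * R -> \bar R) :
  measurable_fun setT f -> (forall z, (0 <= f z)%E) ->
  (\int[lebesgue_measure]_x \int[lebesgue_measure]_y f (x, y) =
   \int[lebesgue_measure]_y \int[lebesgue_measure]_x f (x, y))%E.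
Proof.
move=> mf f0.
exact: (@fubini_tonelli _ _ (measurableTypeR R) (measurableTypeR R) R
  lebesgue_measure lebesgue_measure f mf f0).
Qed.

(* The integrand is [s^(p-1) t^(q-1) e^(-s-t)] at [t = u - s]. *)
Lemma eGammaM {R : realType} (p q : R) :
  (eGamma p * eGamma q = (2 `^ (1 - p - q))%:E * (eGamma (p + q) * eBeta p q))%E.
Proof.
pose f (z : R * R) : \bar R :=
  (pos_powR p z.1 * pos_powR q (z.2 - z.1) * expR (- z.2))%:E.
have f0 z : (0 <= f z)%E.
  by rewrite lee_fin !mulr_ge0 ?pos_powR_ge0 ?expR_ge0.
have mf : measurable_fun setT f.
  apply/measurable_EFinP; apply: measurable_funM; [apply: measurable_funM|].
  - by apply: measurableT_comp; [exact: measurable_pos_powR|].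
  - apply: measurableT_comp; [exact: measurable_pos_powR|].
    exact: measurable_funB.
  - by apply: measurableT_comp => //; exact: measurableT_comp.
have E1 : (eGamma p * eGamma q =
    \int[lebesgue_measure]_s \int[lebesgue_measure]_u f (s, u))%E.
  rewrite /eGamma -ge0_integralZr//.
  - apply: eq_integral => s _.
    have mq := measurable_eGamma_fun q.
    rewrite -/(eGamma q) /eGamma (ge0_integral_affine _ 1 (- s))//.
    + rewrite mul1e -ge0_integralZl//.
      * apply: eq_integral => u _; rewrite /f /= mul1r -EFinM; congr EFin.
        have -> : - u = - s + - (u - s) by ring.
        by rewrite expRD; ring.
      * apply/measurable_EFinP.
        apply: (@measurableT_comp _ _ _ _ _ _ (fun x => pos_powR q x * expR (- x))) => //.
        by apply: measurable_funD => //; apply: measurable_funM.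
      * by move=> x _; rewrite lee_fin mulr_ge0 ?pos_powR_ge0 ?expR_ge0.
      * by rewrite lee_fin mulr_ge0 ?pos_powR_ge0 ?expR_ge0.
    + exact/measurable_EFinP.
    + by move=> x; rewrite lee_fin mulr_ge0 ?pos_powR_ge0 ?expR_ge0.
  - by apply/measurable_EFinP; exact: measurable_eGamma_fun.
  - by move=> x _; rewrite lee_fin mulr_ge0 ?pos_powR_ge0 ?expR_ge0.
  - exact: eGamma_ge0.
apply: (etrans E1); apply: (etrans (lebesgue_tonelli _ mf f0)).
have mG : measurable_fun setT (fun u : R => (pos_powR (p + q) u * expR (- u))%:E).
  by apply/measurable_EFinP; exact: measurable_eGamma_fun.
have G0 (u : R) : (0 <= (pos_powR (p + q) u * expR (- u))%:E)%E.
  by rewrite lee_fin mulr_ge0 ?pos_powR_ge0 ?expR_ge0.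
have E2 : (eGamma (p + q) * eBeta p q =
    \int[lebesgue_measure]_u ((pos_powR (p + q) u * expR (- u))%:E * eBeta p q))%E.
  by rewrite ge0_integralZr//; exact: eBeta_ge0.
have E3 : ((2 `^ (1 - p - q))%:E * (eGamma (p + q) * eBeta p q) =
    \int[lebesgue_measure]_u ((2 `^ (1 - p - q))%:E *
       ((pos_powR (p + q) u * expR (- u))%:E * eBeta p q)))%E.
  rewrite ge0_integralZl//; first by rewrite -E2.
  - exact: emeasurable_funM.
  - by move=> x _; rewrite mule_ge0 ?eBeta_ge0.
apply: etrans (esym E3).
apply: eq_integral => u _; rewrite /f /=.
have [u0|u0] := ltP 0 u.
  under eq_integral do rewrite EFinM.
  rewrite ge0_integralZr//.
  - rewrite integral_pos_powR_conv// muleAC muleA -!EFinM; congr (_%:E * _)%E.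
    (* The constant [2 ^ (1 - p - q)] is the power of 1/2 left by [(u / 2) ^ (p + q - 1)]. *)
    rewrite powRM ?ltW ?invr_gt0// -powR_inv1// -powRrM /pos_powR u0.
    have -> : -1 * (p + q - 1) = 1 - p - q by ring.
    ring.
  - apply/measurable_EFinP; apply: measurable_funM; first exact: measurable_pos_powR.
    by apply: measurableT_comp; [exact: measurable_pos_powR|exact: measurable_funB].
  - by move=> x _; rewrite lee_fin mulr_ge0 ?pos_powR_ge0.
(* For [u <= 0], [s] and [u - s] cannot both be positive, so both sides are 0. *)
rewrite integral0_eq => [|s _].
  by rewrite {1}/pos_powR ltNge u0 mul0r mul0e mule0.
rewrite /pos_powR; case: ifP => s0; last by rewrite !mul0r.
by rewrite ltNge subr_le0 (le_trans u0 (ltW s0)) mulr0 mul0r.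
Qed.

(** At [u = 1] and [q = 1] the convolution reduces to the integral of [s ^ (p - 1)] over the unit
    interval. *)
Lemma eBeta1 {R : realType} (p : R) : 0 < p -> eBeta p 1 = (2 `^ p / p)%:E.
Proof.
move=> p0; have := integral_pos_powR_conv p 1 _ (@ltr01 R).
have -> : (\int[lebesgue_measure]_s (pos_powR p s * pos_powR 1 (1 - s))%:E = (p^-1)%:E)%E.
  rewrite -(integral_powR_unit _ p0) -integral_itv_bndo_bndc; last first.
    by apply: measurable_funTS; apply/measurable_EFinP; exact: measurable_powR.
  rewrite [RHS]integral_mkcond; apply: eq_integral => x _.
  rewrite patchE mem_setE in_itv /= /pos_powR subr_gt0 subrr powRr0.
  by case: ifP; case: ifP; rewrite ?(mulr1, mulr0, mul0r).
have h2 : 0 < (1 / 2 : R) `^ (p + 1 - 1) by rewrite powR_gt0.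
(* An infinite value would make the finite number [p^-1] infinite. *)
have := eBeta_ge0 p 1; case: (eBeta p 1) => // [b b0|_]; last first.
  by rewrite mulry gtr0_sg// mul1e.
rewrite -EFinM => -[e]; congr EFin.
apply: (mulfI (lt0r_neq0 h2)); rewrite -e addrK mulrA mul1r -(@powR_inv1 _ 2)// -powRrM.
by rewrite -powRD ?pnatr_eq0 ?implybT// mulN1r addNr powRr0 mul1r.
Qed.

(** * Functional equation, finiteness and positivity of Gamma *)

Lemma eGamma1 {R : realType} : eGamma (1 : R) = 1%E.
Proof.
rewrite -(@integral_exponential_pdf R 1)// /exponential_pdf.
have mE : measurable_fun [set: R] (fun x : R => (expR (- x))%:E).
  by apply/measurable_EFinP; apply: measurableT_comp => //; exact: measurableT_comp.
transitivity (\int[lebesgue_measure]_(x in `]0%R, +oo[) (expR (- x : R))%:E)%E.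
  rewrite [RHS]integral_mkcond; apply: eq_integral => x _.
  rewrite patchE mem_setE in_itv /= andbT /pos_powR subrr powRr0.
  by case: ifP; rewrite ?(mul1r, mul0r).
rewrite integral_itv_obnd_cbnd; last exact: measurable_funTS.
rewrite integral_mkcond; apply: eq_integral => x _.
by rewrite !patchE; case: ifP => // _; rewrite mul1r mulN1r.
Qed.

(** This is the product formula at [q = 1], in place of integration by parts. It holds in the
    extended reals, hence can serve to prove finiteness. *)
Lemma eGammaS {R : realType} (p : R) : 0 < p ->
  eGamma p = ((p^-1)%:E * eGamma (p + 1))%E.
Proof.
move=> p0; rewrite -[LHS]mule1 -(@eGamma1 R); apply: (etrans (eGammaM p 1)).
rewrite eBeta1// muleCA -EFinM muleC; congr (_%:E * _)%E.
rewrite mulrA -powRD ?pnatr_eq0 ?implybT//.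
by rewrite (_ : 1 - p - 1 + p = 0) ?powRr0 ?mul1r//; ring.
Qed.

Lemma eGamma_fin_numS {R : realType} (p : R) : 0 < p ->
  (eGamma p \is a fin_num) = (eGamma (p + 1) \is a fin_num).
Proof.
move=> p0; rewrite (eGammaS _ p0); have := eGamma_ge0 (p + 1).
case: (eGamma (p + 1)) => // _.
by rewrite mulry gtr0_sg ?invr_gt0// mul1e.
Qed.

(** Positive integers are reached from [eGamma1] by the recursion. In general one passes to [p + 1],
    whose integrand has the nonnegative exponent [p], and dominates it by integer cases. *)
Lemma eGamma_fin_num {R : realType} (p : R) : 0 < p -> eGamma p \is a fin_num.
Proof.
move=> p0; rewrite eGamma_fin_numS//.
have nat_fin n : eGamma (n.+1%:R : R) \is a fin_num.
  elim: n => [|n IH]; first by rewrite eGamma1.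
  by rewrite -natr1 -eGamma_fin_numS.
set n := Num.truncn p.
have pn : p <= n.+1%:R by exact/ltW/truncnS_gt.
have mG (q : R) : measurable_fun setT (fun x : R => (pos_powR q x * expR (- x))%:E).
  by apply/measurable_EFinP; exact: measurable_eGamma_fun.
have G0 (q x : R) : (0 <= (pos_powR q x * expR (- x))%:E)%E.
  by rewrite lee_fin mulr_ge0 ?pos_powR_ge0 ?expR_ge0.
(* Pointwise, [x ^ p] is at most 1 for [x <= 1] and at most [x ^ (n + 1)] beyond. *)
have h : (eGamma (p + 1) <= eGamma 1 + eGamma n.+2%:R)%E.
  rewrite /eGamma -ge0_integralD//; [|exact: mG|exact: mG].
  apply: ge0_le_integral => //.
  - exact: (mG (p + 1)).
  - by apply: emeasurable_funD; exact: mG.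
  - move=> x _; rewrite -EFinD lee_fin -mulrDl ler_wpM2r ?expR_ge0//.
    rewrite /pos_powR; case: ifP => x0; last by rewrite addr0.
    rewrite addrK subrr powRr0 -natr1 addrK.
    have [x1|x1] := leP x 1.
      rewrite -[leLHS]addr0 lerD ?powR_ge0//.
      by rewrite -(powRr0 x) ger_powR ?x0//= ltW.
    by rewrite -[leLHS]add0r lerD// ler_powR// ltW.
rewrite (ge0_fin_numE (eGamma_ge0 _)); apply: (le_lt_trans h).
apply: lte_add_pinfty; first by rewrite eGamma1 ltry.
by rewrite -(ge0_fin_numE (eGamma_ge0 _)).
Qed.

Lemma eGammaE {R : realType} (p : R) : 0 < p -> eGamma p = (Gamma p)%:E.
Proof. by move=> p0; rewrite GammaE fineK// eGamma_fin_num. Qed.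

Lemma GammaS {R : realType} (p : R) : 0 < p -> Gamma (p + 1) = p * Gamma p.
Proof.
move=> p0; have := eGammaS _ p0; rewrite !eGammaE ?addr_gt0// -EFinM => -[->].
by rewrite mulrA divff ?mul1r// gt_eqF.
Qed.

Lemma Gamma_poch {R : realType} (p : R) n : 0 < p ->
  Gamma (p + n%:R) = poch p n * Gamma p.
Proof.
move=> p0; elim: n => [|n IH]; first by rewrite addr0 poch0 mul1r.
rewrite -natr1 addrA GammaS; last exact: ltr_wpDr.
by rewrite IH pochS mulrA (mulrC (poch p n)).
Qed.

(** On the unit interval the exponential is at least [expR (- 1)], which gives the lower bound
    [expR (- 1) / p]. *)
Lemma Gamma_gt0 {R : realType} (p : R) : 0 < p -> 0 < Gamma p.
Proof.
move=> p0; rewrite -lte_fin -eGammaE//.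
have mp : measurable_fun setT (fun x : R => (x `^ (p - 1))%:E).
  by apply/measurable_EFinP; exact: measurable_powR.
have mG : measurable_fun setT (fun x : R => (pos_powR p x * expR (- x))%:E).
  by apply/measurable_EFinP; exact: measurable_eGamma_fun.
have G0 (x : R) : (0 <= (pos_powR p x * expR (- x))%:E)%E.
  by rewrite lee_fin mulr_ge0 ?pos_powR_ge0 ?expR_ge0.
apply: (@lt_le_trans _ _ ((expR (- 1))%:E * (p^-1)%:E)%E).
  by rewrite -EFinM lte_fin mulr_gt0 ?expR_gt0 ?invr_gt0.
rewrite -integral_powR_unit// -ge0_integralZl//; last 2 first.
- exact: measurable_funTS.
- by move=> x _; rewrite lee_fin powR_ge0.
apply: (@le_trans _ _
  (\int[lebesgue_measure]_(x in `]0%R, 1%R]) (pos_powR p x * expR (- x))%:E)%E).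
  apply: ge0_le_integral => //.
  - by move=> x _; rewrite mule_ge0// lee_fin ?expR_ge0 ?powR_ge0.
  - apply: measurable_funTS; apply: emeasurable_funM => //.
  - exact: measurable_funTS.
  - move=> x /=; rewrite in_itv /= => /andP[x0 x1].
    rewrite -EFinM lee_fin /pos_powR x0 mulrC ler_wpM2l ?powR_ge0//.
    by rewrite ler_expR lerN2.
by apply: ge0_subset_integral.
Qed.

Lemma eBetaE {R : realType} (p q : R) : 0 < p -> 0 < q ->
  eBeta p q = (2 `^ (p + q - 1) * (Gamma p * Gamma q / Gamma (p + q)))%:E.
Proof.
move=> p0 q0; have pq : 0 < p + q by rewrite addr_gt0.
have := eGammaM p q; rewrite !eGammaE//.
have G0 := Gamma_gt0 _ pq.
have h2 : 0 < (2 : R) `^ (1 - p - q) by rewrite powR_gt0.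
have := eBeta_ge0 p q; case: (eBeta p q) => // [b _|_]; last first.
  by rewrite mulry gtr0_sg// mul1e mulry gtr0_sg// mul1e.
rewrite -!EFinM => -[->]; congr EFin.
rewrite !mulrA -powRD ?pnatr_eq0 ?implybT//.
rewrite (_ : p + q - 1 + (1 - p - q) = 0); last by ring.
by rewrite powRr0 mul1r mulrAC divff ?mul1r// gt_eqF.
Qed.


(** * Jacobi polynomials and their moments *)

Definition jacobi_subr_coef {R : realType} (n : nat) (a b : R) (j : nat) : R :=
  poch (a + 1) n / n`!%:R * (poch (- n%:R) j * poch (a + b + n%:R + 1) j
    / (poch (a + 1) j * j`!%:R)) / 2 ^+ j.

(** The normalizing factor [poch (a + 1) N] has been cancelled against the denominator of the
    reflected expansion. *)
Definition jacobi_addr_coef {R : realType} (N : nat) (a b : R) (i : nat) : R :=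
  'C(N, i)%:R * poch (a + b + N%:R + 1) i * poch (- b - N%:R) (N - i)
      / N`!%:R / 2 ^+ i.

Lemma jacobiP_subr {R : realType} n (a b x : R) :
  jacobiP n a b x = \sum_(j < n.+1)
    jacobi_subr_coef n a b j * (1 - x) ^+ j.
Proof.
rewrite /jacobiP big_distrr /=; apply: eq_bigr => j _; rewrite /jacobi_subr_coef.
by rewrite expr_div_n mulrA -!mulrA [(1 - x) ^+ j * _]mulrC.
Qed.

Lemma jacobiP_addr {R : realType} n (a b x : R) : -1 < a ->
  jacobiP n a b x = \sum_(i < n.+1)
    jacobi_addr_coef n a b i * (1 + x) ^+ i.
Proof.
move=> a1; have a0 : 0 < a + 1 by rewrite -(subrK 1 0) ltrD2r sub0r.
pose s := (1 + x) / 2.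
have e : (1 - x) / 2 = 1 - s by rewrite /s; field.
rewrite /jacobiP e sum_reflected_term// big_distrr /=; apply: eq_bigr => i _.
have -> : a + 1 - (a + b + n%:R + 1) = - b - n%:R by ring.
rewrite /s /jacobi_addr_coef expr_div_n.
by field; rewrite poch_neq0// fact_neq0 expf_neq0// pnatr_eq0.
Qed.

Definition jacobi_weight {R : realType} (a b x : R) : R :=
  (1 - x) `^ a * (1 + x) `^ b.

Lemma jacobi_weight_pos_powR {R : realType} (a b x : R) j k :
  -1 < x < 1 -> jacobi_weight a b x * (1 - x) ^+ j * (1 + x) ^+ k =
    pos_powR (b + 1 + k%:R) (1 + x) * pos_powR (a + 1 + j%:R) (1 - x).
Proof.
move=> /andP[x1 x2].
have h1 : 0 < 1 - x by rewrite subr_gt0.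
have h2 : 0 < 1 + x by rewrite -ltrBlDl sub0r.
rewrite /jacobi_weight /pos_powR h1 h2.
have -> : b + 1 + k%:R - 1 = b + k%:R by ring.
have -> : a + 1 + j%:R - 1 = a + j%:R by ring.
rewrite !powRD ?(gt_eqF h1) ?(gt_eqF h2) ?implybT// !powR_mulrn ?ltW//.
ring.
Qed.

Lemma measurable_jacobi_moment {R : realType} (a b : R) j k :
  measurable_fun setT
    (fun x : R => jacobi_weight a b x * (1 - x) ^+ j * (1 + x) ^+ k).
Proof.
have m1 : measurable_fun setT (fun x : R => 1 - x) by exact: measurable_funB.
have m2 : measurable_fun setT (fun x : R => 1 + x) by exact: measurable_funD.
apply: measurable_funM; last exact: measurable_funX.
apply: measurable_funM; last exact: measurable_funX.
apply: measurable_funM.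
  exact: (measurableT_comp (measurable_powR _) m1).
exact: (measurableT_comp (measurable_powR _) m2).
Qed.

Lemma integral_jacobi_moment {R : realType} (a b : R) j k : -1 < a -> -1 < b ->
  (\int[lebesgue_measure]_(x in `[(-1)%R, 1%R])
     (jacobi_weight a b x * (1 - x) ^+ j * (1 + x) ^+ k)%:E =
   (2 `^ (a + b + 1) * 2 ^+ (j + k) *
     (Gamma (a + 1 + j%:R) * Gamma (b + 1 + k%:R) /
      Gamma (a + b + 2 + k%:R + j%:R)))%:E)%E.
Proof.
move=> a1 b1.
have a0 : 0 < a + 1 + j%:R by rewrite ltr_wpDr// -ltrBlDr sub0r.
have b0 : 0 < b + 1 + k%:R by rewrite ltr_wpDr// -ltrBlDr sub0r.
have mf : measurable_fun setT
   (fun x : R => (jacobi_weight a b x * (1 - x) ^+ j * (1 + x) ^+ k)%:E).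
  by apply/measurable_EFinP; exact: measurable_jacobi_moment.
(* The null endpoints are removed first: there the weight can be nonzero, since zero to the power
   zero is one, while [pos_powR] vanishes. *)
rewrite -integral_itv_bndo_bndc; last exact: measurable_funTS.
rewrite -integral_itv_obnd_cbnd; last exact: measurable_funTS.
transitivity (eBeta (b + 1 + k%:R) (a + 1 + j%:R)).
  rewrite integral_mkcond; apply: eq_integral => x _.
  rewrite patchE mem_setE in_itv /=; case: ifPn => x1.
    by rewrite jacobi_weight_pos_powR.
  rewrite /pos_powR subr_gt0 -ltrBlDl sub0r.
  by move: x1; rewrite negb_and => /orP[] /negbTE ->; rewrite ?mul0r ?mulr0.
rewrite (eBetaE _ _ b0 a0).
apply: (congr1 EFin).
have -> : b + 1 + k%:R + (a + 1 + j%:R) = a + b + 2 + k%:R + j%:R by ring.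
have -> : 2 `^ (a + b + 2 + k%:R + j%:R - 1) = 2 `^ (a + b + 1) * 2 ^+ (j + k) :> R.
  rewrite -powR_mulrn// -powRD ?pnatr_eq0 ?implybT// natrD.
  by congr (_ `^ _); ring.
move: (Gamma (a + 1 + j%:R)) (Gamma (b + 1 + k%:R)) => A B.
by rewrite (mulrC B).
Qed.

(** The integrand is nonnegative on the interval and its integral has just been found finite. *)
Lemma jacobi_moment_integrable {R : realType} (a b : R) j k : -1 < a -> -1 < b ->
  lebesgue_measure.-integrable `[(-1)%R, 1%R]
    (fun x : R => (jacobi_weight a b x * (1 - x) ^+ j * (1 + x) ^+ k)%:E).
Proof.
move=> a1 b1; apply/integrableP; split.
  apply: measurable_funTS; apply/measurable_EFinP.
  exact: measurable_jacobi_moment.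
have := integral_jacobi_moment _ _ j k a1 b1 => e.
apply: (@le_lt_trans _ _ (\int[lebesgue_measure]_(x in `[(-1)%R, 1%R])
     (jacobi_weight a b x * (1 - x) ^+ j * (1 + x) ^+ k)%:E)%E); last by rewrite e ltry.
rewrite le_eqVlt; apply/orP; left; apply/eqP; apply: eq_integral.
move=> x; rewrite inE /= in_itv /= => /andP[x1 x2]; rewrite ger0_norm//.
by rewrite !mulr_ge0 ?powR_ge0 ?exprn_ge0 ?subr_ge0// -lerBlDl sub0r.
Qed.

(** * Term-by-term integration against the Jacobi weight *)

Lemma Rintegral_sum {d} {T : measurableType d} {R : realType}
    (mu : {measure set T -> \bar R}) (D : set T) (I : Type) (r : seq I)
    (F : I -> T -> R) : measurable D ->
  (forall i, mu.-integrable D (EFin \o F i)) ->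
  Rintegral mu D (fun x => \sum_(i <- r) F i x) =
  \sum_(i <- r) Rintegral mu D (F i).
Proof.
move=> mD iF; elim: r => [|i r IH].
  rewrite big_nil /Rintegral.
  by under eq_integral do rewrite big_nil; rewrite integral0.
rewrite big_cons -IH -RintegralD//; first by apply: eq_Rintegral => x _; rewrite big_cons.
rewrite (_ : EFin \o _ = (fun x => \sum_(i <- r) (F i x)%:E)%E).
  by apply: integrable_sum => // k _; exact: iF.
by apply/funext => x /=; rewrite sumEFin.
Qed.

Lemma Rintegral_jacobi_weight {R : realType} (a b : R) (p q : nat -> R) n N :
  -1 < a -> -1 < b ->
  Rintegral (@lebesgue_measure R) `[-1, 1]
    (fun x => jacobi_weight a b x * (\sum_(j < n) p j * (1 - x) ^+ j)
       * (\sum_(k < N) q k * (1 + x) ^+ k)) =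
  \sum_(k < N) q k * \sum_(j < n) p j *
     (2 `^ (a + b + 1) * 2 ^+ (j + k) *
     (Gamma (a + 1 + j%:R) * Gamma (b + 1 + k%:R) /
      Gamma (a + b + 2 + k%:R + j%:R))).
Proof.
move=> a1 b1.
pose F (jk : 'I_N * 'I_n) (x : R) : R :=
  q jk.1 * p jk.2 * (jacobi_weight a b x * (1 - x) ^+ jk.2 * (1 + x) ^+ jk.1).
have iM j k := jacobi_moment_integrable _ _ j k a1 b1.
transitivity (Rintegral (@lebesgue_measure R) `[-1, 1] (fun x => \sum_jk F jk x)).
  apply: eq_Rintegral => x _; rewrite -(pair_bigA _ (fun k j => F (k, j) x)) /=.
  rewrite big_distrr /=; apply: eq_bigr => k _.
  rewrite big_distrr /= big_distrl /=; apply: eq_bigr => j _; rewrite /F /=; ring.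
rewrite Rintegral_sum//; last first.
  move=> jk; rewrite (_ : EFin \o _ = (fun x : R => (q jk.1 * p jk.2)%:E *
     (jacobi_weight a b x * (1 - x) ^+ jk.2 * (1 + x) ^+ jk.1)%:E)%E).
    by apply: integrableZl => //; exact: iM.
  by apply/funext => x /=; rewrite -EFinM.
rewrite -(pair_bigA _ (fun k j =>
  Rintegral (@lebesgue_measure R) `[-1, 1] (F (k, j)))) /=.
apply: eq_bigr => k _; rewrite big_distrr /=; apply: eq_bigr => j _.
rewrite /F /= RintegralZl//; last exact: iM.
by rewrite mulrA /Rintegral integral_jacobi_moment.
Qed.

(** [Gamma (a + 1 + j)] cancels [poch (a + 1) j], leaving a Gauss sum at 1 with upper parameters
    [- n], [a + b + n + 1] and lower parameter [a + b + 2 + k]. The factor ['C(k, n)] expresses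
    orthogonality to lower degrees. *)
Lemma jacobi_coef_moment {R : realType} (a b : R) n k : -1 < a -> -1 < b ->
  \sum_(j < n.+1)
    jacobi_subr_coef n a b j *
    (2 `^ (a + b + 1) * 2 ^+ (j + k) *
     (Gamma (a + 1 + j%:R) * Gamma (b + 1 + k%:R) /
      Gamma (a + b + 2 + k%:R + j%:R))) =
  2 `^ (a + b + 1) * 2 ^+ k * 'C(k, n)%:R *
    (Gamma (a + 1 + n%:R) * Gamma (b + 1 + k%:R) /
      Gamma (a + b + 2 + k%:R + n%:R)).
Proof.
move=> a1 b1; have a0 : 0 < a + 1 by rewrite -ltrBlDr sub0r.
have c0 : 0 < a + b + 2 + k%:R by rewrite ltr_wpDr//; lra.
have G0 : Gamma (a + b + 2 + k%:R) != 0 by rewrite gt_eqF// Gamma_gt0.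
have p2 i : (2 : R) ^+ i != 0 by rewrite expf_neq0// pnatr_eq0.
have cv := chu_vandermonde_quotient n (a + b + n%:R + 1) _ c0.
(* The base is [k + 1 - n], so this is the falling factorial of [k], read off by computing
   [poch (- k) n] in two ways. *)
have e : poch (a + b + 2 + k%:R - (a + b + n%:R + 1)) n = n`!%:R * 'C(k, n)%:R :> R.
  have s0 : (-1) ^+ n != 0 :> R by rewrite expf_neq0// oppr_eq0 oner_eq0.
  have := pochN_nat (R := R) k n; rewrite pochN => /(mulfI s0) h.
  rewrite (_ : _ - _ = k%:R + 1 - n%:R); last by ring.
  by rewrite h -bin_ffact natrM mulrC.
rewrite e in cv.
transitivity (2 `^ (a + b + 1) * 2 ^+ k *
   (poch (a + 1) n * Gamma (a + 1) * Gamma (b + 1 + k%:R) /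
      Gamma (a + b + 2 + k%:R) / n`!%:R) *
   (n`!%:R * 'C(k, n)%:R / poch (a + b + 2 + k%:R) n)).
  rewrite -cv big_distrr /=; apply: eq_bigr => j _.
  rewrite (Gamma_poch _ j a0) (Gamma_poch _ j c0) exprD /jacobi_subr_coef.
  move: (Gamma (a + 1)) (Gamma (b + 1 + k%:R)) (Gamma (a + b + 2 + k%:R)) G0 => A B G G0.
  by field; rewrite G0 !poch_neq0// !fact_neq0 p2.
rewrite (Gamma_poch _ n a0) (Gamma_poch _ n c0).
move: (Gamma (a + 1)) (Gamma (b + 1 + k%:R)) (Gamma (a + b + 2 + k%:R)) G0 => A B G G0.
by field; rewrite G0 !poch_neq0// !fact_neq0.
Qed.

(** * The shifted polynomial and the comparison with the Appell sum *)

Lemma jacobiP_shift {R : realType} N (a b x y : R) : -1 < a ->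
  jacobiP N a b (x + y) = \sum_(k < N.+1)
    (\sum_(i < N.+1) jacobi_addr_coef N a b i * 'C(i, k)%:R * y ^+ (i - k))
     * (1 + x) ^+ k.
Proof.
move=> a1; rewrite jacobiP_addr//.
under [RHS]eq_bigr do rewrite big_distrl /=.
rewrite exchange_big /=; apply: eq_bigr => i _.
have -> : 1 + (x + y) = y + (1 + x) by ring.
rewrite exprDn big_distrr /=.
rewrite (big_ord_widen N.+1 (fun k => jacobi_addr_coef N a b i *
  (y ^+ (i - k) * (1 + x) ^+ k *+ 'C(i, k))))//.
rewrite big_mkcond /=; apply: eq_bigr => k _.
case: ifPn => [_|]; first by rewrite -mulr_natl; ring.
by rewrite ltnS -ltnNge => ik; rewrite bin_small// mulr0 !mul0r.
Qed.

Lemma Rmn_moments {R : realType} (a b : R) m n y : -1 < a -> -1 < b ->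
  Rmn a b m n y =
  \sum_(k < (n + m).+1)
    (\sum_(i < (n + m).+1)
       jacobi_addr_coef (n + m) a b i * 'C(i, k)%:R * y ^+ (i - k)) *
    (2 `^ (a + b + 1) * 2 ^+ k * 'C(k, n)%:R *
      (Gamma (a + 1 + n%:R) * Gamma (b + 1 + k%:R) /
       Gamma (a + b + 2 + k%:R + n%:R))).
Proof.
move=> a1 b1; rewrite /Rmn.
pose q k := \sum_(i < (n + m).+1)
   jacobi_addr_coef (n + m) a b i * 'C(i, k)%:R * y ^+ (i - k).
transitivity (Rintegral (@lebesgue_measure R) `[-1, 1]
    (fun x => jacobi_weight a b x *
       (\sum_(j < n.+1) jacobi_subr_coef n a b j * (1 - x) ^+ j)
       * (\sum_(k < (n + m).+1) q k * (1 + x) ^+ k))).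
  by apply: eq_Rintegral => x _; rewrite jacobiP_subr jacobiP_shift.
rewrite Rintegral_jacobi_weight//; apply: eq_bigr => k _.
by rewrite -jacobi_coef_moment.
Qed.

(** The dictionary between the two double sums: the power [n + k] of [1 + x] taken from degree
    [n + m - l] corresponds to the Appell term of index [(k, l)], both carrying
    [y ^+ (m - k - l)]. *)
Lemma Rmn_term {R : realType} (a b : R) m n k l : -1 < a -> -1 < b ->
  (k + l <= m)%N ->
  jacobi_addr_coef (n + m) a b (n + m - l) * 'C(n + m - l, n + k)%:R *
    (2 `^ (a + b + 1) * 2 ^+ (n + k) * 'C(n + k, n)%:R *
      (Gamma (a + 1 + n%:R) * Gamma (b + 1 + (n + k)%:R) /
       Gamma (a + b + 2 + (n + k)%:R + n%:R))) =
  2 `^ (a + b + 1)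
    * (Gamma (a + n%:R + 1) * Gamma (b + n%:R + 1) / Gamma (a + b + 2 * n%:R + 2))
    * poch (a + b + (m + n)%:R + 1) (m + n)
    / (n`!%:R * m`!%:R)
    * (2 ^+ m)^-1
    * ((poch (- (m%:R)) (k + l) * poch (b + n%:R + 1) k * poch (- b - m%:R - n%:R) l
        / (poch (a + b + 2 * n%:R + 2) k * poch (- a - b - 2 * m%:R - 2 * n%:R) l
             * k`!%:R * l`!%:R))
     * (-2) ^+ k * 2 ^+ l).
Proof.
move=> a1 b1 klm.
have lm : (l <= m)%N by apply: leq_trans klm; exact: leq_addl.
have lN : (l <= n + m)%N by apply: leq_trans lm _; exact: leq_addl.
have b0 : 0 < b + n%:R + 1 by rewrite addrAC ltr_wpDr// -ltrBlDr sub0r.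
have c0 : 0 < a + b + 2 * n%:R + 2 by rewrite addrAC ltr_wpDr ?mulr_ge0//; lra.
have G0 : Gamma (a + b + 2 * n%:R + 2) != 0 by rewrite gt_eqF// Gamma_gt0.
have p2 i : (2 : R) ^+ i != 0 by rewrite expf_neq0// pnatr_eq0.
rewrite (_ : a + 1 + n%:R = a + n%:R + 1); last by ring.
rewrite (_ : b + 1 + (n + k)%:R = b + n%:R + 1 + k%:R); last by rewrite natrD; ring.
rewrite (_ : a + b + 2 + (n + k)%:R + n%:R = a + b + 2 * n%:R + 2 + k%:R);
  last by rewrite natrD; ring.
rewrite (Gamma_poch _ k b0) (Gamma_poch _ k c0).
move: (Gamma (a + n%:R + 1)) (Gamma (b + n%:R + 1))
  (Gamma (a + b + 2 * n%:R + 2)) (2 `^ (a + b + 1)) G0 => A B C P C0.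
rewrite /jacobi_addr_coef (addnC m n) subKn//.
rewrite (_ : - b - (n + m)%:R = - b - m%:R - n%:R); last by rewrite natrD; ring.
set lam := a + b + (n + m)%:R + 1.
(* The first factors occur in the Jacobi coefficient; the last [l] are, up to sign, the second
   Appell denominator. *)
have lamE : poch lam (n + m) = poch lam (n + m - l) * poch (lam + (n + m - l)%:R) l.
  by rewrite -pochD subnK.
have cE : poch (- a - b - 2 * m%:R - 2 * n%:R) l =
    (-1) ^+ l * poch (lam + (n + m - l)%:R) l.
  rewrite (_ : - a - b - _ - _ = - (a + b + 2 * m%:R + 2 * n%:R)); last by ring.
  by rewrite pochN natrB//; congr (_ * poch _ _); rewrite /lam natrD; ring.
(* For [l = 0] the product is empty; otherwise [n + m >= 1], which makes [lam] positive. *)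
have D0 : poch (lam + (n + m - l)%:R) l != 0.
  case: l klm lm lN lamE cE => [|l] klm lm lN _ _; first by rewrite poch0 oner_neq0.
  apply: poch_neq0; rewrite /lam addrAC addrAC ltr_wpDr//.
  have : 1 <= (n + m)%:R :> R by rewrite ler1n (leq_trans _ lN).
  lra.
rewrite lamE cE pochN_nat//.
move: (poch lam (n + m - l)) (poch (lam + (n + m - l)%:R) l) D0 => L D D0.
rewrite (bin_factE (n + m) (n + m - l)) ?leq_subr// subKn//.
have nk : (n + k <= n + m - l)%N by lia.
rewrite (bin_factE (n + m - l))// (bin_factE (n + k))// ?leq_addr// addKn.
have -> : (n + m - l - (n + k) = m - (k + l))%N by lia.
have -> : (m ^_ (k + l))%:R = m`!%:R / (m - (k + l))`!%:R :> R.
  by rewrite -(ffact_fact klm) natrM mulfK// fact_neq0.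
rewrite (exprNn 2).
have -> : (2 : R) ^+ (n + k) = 2 ^+ n * 2 ^+ k by rewrite exprD.
have e2 : (2 : R) ^+ n * 2 ^+ m = 2 ^+ (n + m - l) * 2 ^+ l.
  by rewrite -!exprD subnK.
have -> : (2 : R) ^+ n = 2 ^+ (n + m - l) * 2 ^+ l / 2 ^+ m by rewrite -e2 mulfK.
have sE i : ((-1) ^+ i)^-1 = (-1) ^+ i :> R.
  by rewrite -signr_odd; case: odd; rewrite ?invrN invr1.
have cp := poch_neq0 _ k c0.
have s0 i : (-1) ^+ i != 0 :> R by rewrite expf_neq0// oppr_eq0 oner_eq0.
rewrite (exprD (-1)).
(* The signs are placed so as to cancel those of [(-2) ^+ k] and of the second Appell
   denominator. *)
have -> : (-1) ^+ k * (-1) ^+ l * (m`!%:R / (m - (k + l))`!%:R) =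
   (m`!%:R / (m - (k + l))`!%:R) * (-1) ^+ l / (-1) ^+ k :> R by rewrite sE; ring.
by field; rewrite cp C0 D0 !s0 !fact_neq0 !p2.
Qed.

(** The second Gamma quotient is written as a Pochhammer symbol, which keeps its meaning for
    [m = n = 0] and [a + b + 1 <= 0], where the Gamma integral diverges. *)
Theorem theorem1 (R : realType) (a b : R) (m n : nat) (y : R) :
  -1 < a -> -1 < b ->
  Rmn a b m n y =
    2 `^ (a + b + 1)
    * (Gamma (a + n%:R + 1) * Gamma (b + n%:R + 1) / Gamma (a + b + 2 * n%:R + 2))
    * poch (a + b + (m + n)%:R + 1) (m + n)
    / (n`!%:R * m`!%:R)
    * (2 ^+ m)^-1
    * yF2 m (b + n%:R + 1) (- b - m%:R - n%:R) (a + b + 2 * n%:R + 2)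
          (- a - b - 2 * m%:R - 2 * n%:R) y.
Proof.
move=> a1 b1; rewrite Rmn_moments// /yF2 [RHS]big_distrr /=.
(* Powers of [1 + x] below [n] drop out by orthogonality. *)
rewrite -addnS big_split_ord /= big1 ?add0r => [|k _]; last first.
  by rewrite bin_small// mulr0 mul0r mulr0.
apply: eq_bigr => k _; have km : (k <= m)%N by rewrite -ltnS.
rewrite big_distrl [RHS]big_distrr /=.
(* The degree is counted down from the top, as [n + m - l]. *)
rewrite (reindex_inj rev_ord_inj) /=.
rewrite (big_ord_widen (n + m.+1)%N
  (fun l => _ * (poch (- (m%:R)) (k + l) * poch (b + n%:R + 1) k
        * poch (- b - m%:R - n%:R) l
        / (poch (a + b + 2 * n%:R + 2) k * poch (- a - b - 2 * m%:R - 2 * n%:R) l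
             * k`!%:R * l`!%:R)
     * (-2) ^+ k * 2 ^+ l * y ^+ (m - k - l)))); last by lia.
rewrite [RHS]big_mkcond /=; apply: eq_bigr => l _.
have lN : (l <= n + m)%N by rewrite -ltnS -addnS.
rewrite (_ : (n + m.+1 - l.+1 = n + m - l)%N); last by lia.
(* Beyond the Appell range, [l > m - k], the binomial ['C(n + m - l, n + k)] is zero. *)
case: ifPn => [lkm|]; last first.
  by rewrite -leqNgt => h; rewrite bin_small ?mulr0 ?mul0r//; lia.
have klm : (k + l <= m)%N by lia.
have -> : (n + m - l - (n + k) = m - k - l)%N by lia.
rewrite [RHS]mulrA -Rmn_term//.
exact: mulrAC.
Qed.
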